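(* Let $D=(x_{ik})$ be a U-type $(n,m,s^p)$ design and let $z_{ik}=(2x_{ik}+1)/(2s^p)$. Then $$\Phi_{\rm SD}(D)=\frac{1}{n^2m(m-1)}\sum_{a=1}^n\sum_{b=1}^n d_{ab}^2+C_{\rm SD}(m,s,p),$$ where the constant $C_{\rm SD}(m,s,p)$ depends only on $(m,s,p)$ and the weight function $\omega(\cdot)$, and is given by $$C_{\rm SD}(m,s,p)=-\frac{m}{m-1}A_0^2+\frac{2m}{m-1}A_0A_1-A_1^2-\frac{1}{m-1}B-\frac{2}{m-1}C$$ with $$A_0=\sum_{i=0}^p\frac{\omega(i)}{s^i},\qquad A_1=\sum_{i=0}^p\frac{\omega(i)}{s^{2i}},\qquad B=\sum_{i=0}^p\frac{\omega(i)^2}{s^{3i}},\qquad C=\sum_{0\le i<j\le p}\frac{\omega(i)\omega(j)}{s^{i+2j}}.$$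
   Context: Fix integers $s\ge 2$, $p\ge 1$, $m\ge 2$, and a weight function $\omega:\{0,1,\ldots,p\}\to[0,\infty)$ with $\omega(i)>0$ for at least one $i$. Designs. For a positive integer $q$, $\mathbb{Z}_q=\{0,1,\ldots,q-1\}$. An $(n,m,s^p)$ design is an $n\times m$ matrix $D=(x_{ik})$ with entries in $\mathbb{Z}_{s^p}$ (rows are runs, columns are factors; rows may repeat). It is U-type if in every column each of the $s^p$ levels appears equally often. $D$ is identified with the $n$ points (counted with multiplicity) $\mathbf z_i=(z_{i1},\ldots,z_{im})\in[0,1)^m$, $z_{ik}=(2x_{ik}+1)/(2s^p)$. Stratified $L_2$-discrepancy. For $u\in\{0,\ldots,p\}$ and $x\in[0,1)$ let $R_u(x)=\big[\lfloor s^ux\rfloor/s^u,\ \lfloor s^ux\rfloor/s^u+1/s^u\big)$. For a collection $P$ of $n$ points of $[0,1)^r$ (with multiplicity), $\mathbf u=(u_1,\ldots,u_r)\in\{0,\ldots,p\}^r$ and $\mathbf x\in[0,1)^r$, let $R_{\mathbf u}(\mathbf x)=R_{u_1}(x_1)\times\cdots\times R_{u_r}(x_r)$, which has volume $s^{-\sum_j u_j}$, and let $\omega(\mathbf u)=\prod_{j=1}^r\omega(u_j)$. The squared stratified $L_2$-discrepancy is $$\mathrm{SD}^2(P)=\sum_{\mathbf u\in\{0,\ldots,p\}^r}\omega(\mathbf u)\int_{[0,1)^r}\left|s^{-\sum_j u_j}-\frac{|P\cap R_{\mathbf u}(\mathbf x)|}{n}\right|^2 d\mathbf x .$$ For a design,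 $\mathrm{SD}^2$ denotes $\mathrm{SD}^2$ of the associated points. Uniform projection criterion. $$\Phi_{\rm SD}(D)=\frac{2}{m(m-1)}\sum_{u\subset\{1,\ldots,m\},\,|u|=2}\mathrm{SD}^2(D_u),$$ where $D_u$ is the $n\times 2$ subdesign of $D$ formed by the columns indexed by $u$. Weighted hierarchical distance. For $x,y\in[0,1)$ and $i=0,\ldots,p$ let $\delta_i(x,y)=1$ if $\lfloor s^ix\rfloor=\lfloor s^iy\rfloor$ and $0$ otherwise. For $a,b\in\{1,\ldots,n\}$, $$d_{ab}=\sum_{k=1}^m\sum_{i=0}^p\frac{\omega(i)}{s^i}\bigl\{1-\delta_i(z_{ak},z_{bk})\bigr\}.$$ *)

(* Defs.v *)
From HB Require Import structures.
From mathcomp Require Import all_boot all_order all_algebra.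
From mathcomp Require Import all_classical all_reals all_analysis.
Set Implicit Arguments.
Unset Strict Implicit.
Unset Printing Implicit Defensive.
Import Order.TTheory GRing.Theory Num.Theory.
Import numFieldNormedType.Exports.

Local Open Scope classical_set_scope.
Local Open Scope ring_scope.

Section LebesgueTuple.
Variable R : realType.
Notation T := (measurableTypeR R).

Definition tcons r (xt : T * r.-tuple T) : r.+1.-tuple T :=
  [tuple of xt.1 :: xt.2].

Definition tuncons r (t : r.+1.-tuple T) : T * r.-tuple T :=
  (tnth t ord0, [tuple of behead t]).

Lemma tunconsK r : cancel (@tuncons r) (@tcons r).
Proof. by move=> t; rewrite /tcons /= [RHS]tuple_eta; apply: val_inj. Qed.

Lemma tconsK r : cancel (@tcons r) (@tuncons r).
Proof. by move=> [x t]; congr (_, _); apply: val_inj. Qed.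

Lemma measurable_tcons r : measurable_fun [set: T * r.-tuple T] (@tcons r).
Proof. by apply: measurable_cons. Qed.

Lemma measurable_tuncons r : measurable_fun [set: r.+1.-tuple T] (@tuncons r).
Proof.
apply: measurable_fun_pair; [exact: measurable_tnth|exact: measurable_behead].
Qed.

Section Cons.
Variables (r : nat) (mu : {sigma_finite_measure set (r.-tuple T) -> \bar R}).

(* The product of the Lebesgue measure on R with mu, transported along the
   bijection tcons from R * R^r to R^(r+1). *)
Definition lebesgue_cons : set (r.+1.-tuple T) -> \bar R :=
  pushforward (lebesgue_measure \x mu)%E (@tcons r).

Let lebesgue_cons0 : lebesgue_cons set0 = 0%E.
Proof. by rewrite /lebesgue_cons /pushforward preimage_set0 measure0. Qed.

Let lebesgue_cons_ge0 A : (0 <= lebesgue_cons A)%E.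
Proof. exact: (measure_ge0 (lebesgue_measure \x mu)%E). Qed.

Let lebesgue_cons_sigma_additive : semi_sigma_additive lebesgue_cons.
Proof.
exact: (@measure_semi_sigma_additive _ _ _
  (measure_function_pushforward__canonical__measure_function_Measure
    _ (@measurable_tcons r))).
Qed.

HB.instance Definition _ := isMeasure.Build _ _ _ lebesgue_cons
  lebesgue_cons0 lebesgue_cons_ge0 lebesgue_cons_sigma_additive.

Let lebesgue_cons_sigma_finite : sigma_finite setT lebesgue_cons.
Proof.
have /sigma_finiteP[F [TF ndF Foo]] := sigma_finiteT (@lebesgue_measure R).
have /sigma_finiteP[G [TG ndG Goo]] := sigma_finiteT mu.
exists (fun i => @tuncons r @^-1` (F i `*` G i)).
  rewrite -preimage_bigcup -(preimage_setT (@tuncons r)); congr (_ @^-1` _).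
  rewrite -setXTT TF TG predeqE => -[x y]; split => [[/= [i _ Fx] [j _ Gy]]|].
    exists (maxn i j) => //; split => /=.
      by move: x Fx; exact/subsetPset/ndF/leq_maxl.
    by move: y Gy; exact/subsetPset/ndG/leq_maxr.
  by move=> [i _ [/= ? ?]]; split; exists i.
move=> i; have [mF Fioo] := Foo i; have [mG Gioo] := Goo i; split.
  rewrite -[X in measurable X]setTI; apply: measurable_tuncons => //.
  exact: measurableX.
rewrite /lebesgue_cons /pushforward -comp_preimage.
rewrite (_ : _ \o _ = id); last by apply/funext => x /=; rewrite tconsK.
by rewrite preimage_id product_measure1E// lte_mul_pinfty// ge0_fin_numE.
Qed.

HB.instance Definition _ := Measure_isSigmaFinite.Build _ _ _ lebesgue_cons
  lebesgue_cons_sigma_finite.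

End Cons.

(* The r-dimensional Lebesgue measure. *)
Fixpoint lebesgue_tuple r : {sigma_finite_measure set (r.-tuple T) -> \bar R} :=
  match r with
  | 0 => dirac [tuple]
  | r'.+1 => lebesgue_cons (lebesgue_tuple r')
  end.

Lemma lebesgue_tuple_box r (A : 'I_r -> set T) :
  (forall j, measurable (A j)) ->
  lebesgue_tuple r [set t | forall j, A j (tnth t j)] =
  (\prod_(j < r) lebesgue_measure (A j))%E.
Proof.
elim: r A => [|r IH] A mA.
  by rewrite big_ord0 /= diracE mem_set// => -[].
rewrite big_ord_recl -(IH (fun j => A (lift ord0 j)))// /= /lebesgue_cons.
rewrite /pushforward -product_measure1E//; last first.
  rewrite (_ : [set _ | _] =
      \bigcap_(j in [set: 'I_r]) ((fun t => tnth t j) @^-1` A (lift ord0 j))).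
    apply: fin_bigcap_measurable => // j _; rewrite -[X in measurable X]setTI.
    by apply: measurable_tnth.
  by apply/seteqP; split => t /= h j; [move=> _|]; exact: h.
congr (product_measure1 _ _ _); apply/seteqP; split => -[x t] /=.
  move=> h; split; first by have := h ord0.
  by move=> j; have := h (lift ord0 j); rewrite tnthS.
move=> [h0 h] j; case: (unliftP ord0 j) => [i ->|->] //.
by rewrite tnthS.
Qed.

End LebesgueTuple.

Section Design.
Variables (R : realType) (s p : nat).

Definition U_type n m (D : 'M['I_(s ^ p)]_(n, m)) : Prop :=
  forall (k : 'I_m) (l l' : 'I_(s ^ p)),
    #|[pred i | D i k == l]| = #|[pred i | D i k == l']|.

Definition level_point (x : 'I_(s ^ p)) : R := (2 * x + 1)%N%:R / (2 * s ^ p)%N%:R.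

Definition design_points n r (D : 'M['I_(s ^ p)]_(n, r)) (i : 'I_n) :
  r.-tuple R := [tuple level_point (D i k) | k < r].

Definition elem_interval (u : nat) (x : R) : set R :=
  let a := (Num.floor (s%:R ^+ u * x))%:~R / s%:R ^+ u in
  `[a, a + 1 / s%:R ^+ u[.

Definition elem_box r (u : {ffun 'I_r -> 'I_p.+1}) (x : r.-tuple R) :
  set (r.-tuple R) :=
  [set y | forall j, elem_interval (u j) (tnth x j) (tnth y j)].

Definition unit_cube r : set (r.-tuple R) :=
  [set x | forall j, tnth x j \in `[0, 1[].

Variable omega : 'I_p.+1 -> R.

(* The family P, indexed by 'I_n, is a collection of n points with
   multiplicity: points are counted by their index. *)
Definition SD2 n r (P : 'I_n -> r.-tuple R) : R :=
  \sum_(u : {ffun 'I_r -> 'I_p.+1})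
    (\prod_(j < r) omega (u j)) *
    \int[@lebesgue_tuple R r]_(x in @unit_cube r)
      (`| (s%:R ^+ (\sum_(j < r) u j)%N)^-1
          - #|[pred i | P i \in elem_box u x]|%:R / n%:R | ^+ 2).

(* The subdesign of D formed by the columns in A is a matrix with #|A|
   columns, listed by enum_val. *)
Definition Phi_SD n m (D : 'M['I_(s ^ p)]_(n, m)) : R :=
  2 / (m%:R * (m%:R - 1)) *
  \sum_(A : {set 'I_m} | #|A| == 2%N)
    SD2 (design_points (colsub (@enum_val _ (mem A)) D)).

Definition same_cell (i : nat) (x y : R) : bool :=
  Num.floor (s%:R ^+ i * x) == Num.floor (s%:R ^+ i * y).

Definition hdist n m (D : 'M['I_(s ^ p)]_(n, m)) (a b : 'I_n) : R :=
  \sum_(k < m) \sum_(i < p.+1) omega i / s%:R ^+ i *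
    (1 - (same_cell i (level_point (D a k)) (level_point (D b k)))%:R).

Definition A0 : R := \sum_(i < p.+1) omega i / s%:R ^+ i.
Definition A1 : R := \sum_(i < p.+1) omega i / s%:R ^+ (2 * i)%N.
Definition B : R := \sum_(i < p.+1) omega i ^+ 2 / s%:R ^+ (3 * i)%N.
Definition C : R :=
  \sum_(i < p.+1) \sum_(j < p.+1 | (i < j)%N)
    omega i * omega j / s%:R ^+ (i + 2 * j)%N.

Definition C_SD (m : nat) : R :=
  - (m%:R / (m%:R - 1)) * A0 ^+ 2
  + (2 * m%:R) / (m%:R - 1) * A0 * A1
  - A1 ^+ 2
  - 1 / (m%:R - 1) * B
  - 2 / (m%:R - 1) * C.

End Design.

(* Main.v *)
(* Let K(x, y) = sum_i omega(i) s^(-i) delta_i(x, y). Two points share a box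
   R_u(x) exactly when all their delta's are 1, so expanding the square in the
   discrepancy and integrating gives
     SD^2(P) = n^(-2) sum_(a, b) prod_j K(a_j, b_j) - A_1^r
   for points of [0,1)^r. With K_k(a, b) = K(z_ak, z_bk), the sum of K_k K_l over
   pairs k < l is half of (sum_k K_k)^2 - sum_k K_k^2, and
   d_ab = m A_0 - sum_k K_k(a, b). Being U-type fixes the remaining moments:
   sum_(a, b) delta_i = n^2 / s^i in each column, hence sum_(a, b) K_k = n^2 A_1
   and, since delta_i delta_j = delta_max(i, j), sum_(a, b) K_k^2 = n^2 (B + 2 C). *)
Require Import Defs.
From mathcomp Require Import all_boot all_order all_algebra.
From mathcomp Require Import all_classical all_reals all_analysis.
From mathcomp Require Import ring zify.
Set Implicit Arguments.
Unset Strict Implicit.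
Unset Printing Implicit Defensive.
Import Order.TTheory GRing.Theory Num.Theory.
Local Open Scope ring_scope.

(** * Elementary intervals and boxes as classes of points with equal floors *)

Lemma elem_intervalE (R : realType) (s u : nat) (x : R) : (0 < s)%N ->
  elem_interval s u x = [set y | same_cell s u x y]%classic.
Proof.
move=> s0; have su : 0 < s%:R ^+ u :> R by rewrite exprn_gt0// ltr0n.
apply/seteqP; split=> y; rewrite /elem_interval /same_cell /= in_itv/= -mulrDl.
  rewrite ler_pdivrMr// ltr_pdivlMr// ![y * _]mulrC -[1]/(1%:~R) -intrD => h.
  by rewrite (floor_def h).
move=> /eqP ->; rewrite ler_pdivrMr// ltr_pdivlMr// ![y * _]mulrC.
by have := floor_itv (s%:R ^+ u * y); rewrite intrD.
Qed.

Lemma measurable_elem_interval (R : realType) (s u : nat) (x : R) :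
  measurable (elem_interval s u x).
Proof. exact: measurable_itv. Qed.

Lemma lebesgue_measure_elem_interval (R : realType) (s u : nat) (x : R) :
  (0 < s)%N ->
  lebesgue_measure (elem_interval s u x) = ((s%:R ^+ u)^-1)%:E.
Proof.
move=> s0; have su : 0 < s%:R ^+ u :> R by rewrite exprn_gt0// ltr0n.
rewrite /elem_interval lebesgue_measure_itv/= lte_fin ltrDl divr_gt0//.
by rewrite -EFinD addrAC subrr add0r div1r.
Qed.

Lemma elem_interval_sub (R : realType) (s u : nat) (x : R) : (0 < s)%N ->
  x \in `[0, 1[ -> (elem_interval s u x `<=` `[0%R, 1%R[)%classic.
Proof.
move=> s0; have su : 0 < s%:R ^+ u :> R by rewrite exprn_gt0// ltr0n.
rewrite in_itv/= => /andP[x0 x1]; rewrite elem_intervalE// => y /=.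
rewrite /same_cell => /eqP e; rewrite in_itv/=; apply/andP; split.
  rewrite -(pmulr_rge0 _ su) -floor_ge0 -e floor_ge0.
  by rewrite mulr_ge0// ltW.
rewrite -(ltr_pM2l su) mulr1 -[ltRHS]natrX.
(* The bound [s ^ u] is an integer, so lying below it depends only on the floor, which [x] and [y]
   share. *)
rewrite -[ltRHS]/((s ^ u)%N%:~R) -floor_lt_int -e floor_lt_int.
by rewrite -[ltRHS]/((s ^ u)%N%:R) natrX -[ltRHS]mulr1 ltr_pM2l.
Qed.

(** Reduces membership to finitely many equalities of floors, from which symmetry and transitivity
    of sharing a box are immediate. *)
Lemma elem_boxP (R : realType) (s p r : nat) (u : {ffun 'I_r -> 'I_p.+1})
    (x y : r.-tuple R) : (0 < s)%N ->
  (y \in elem_box s u x) =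
    [forall j, same_cell s (u j) (tnth x j) (tnth y j)].
Proof.
move=> s0; apply/idP/forallP => [/set_mem h j|h].
  by have := h j; rewrite elem_intervalE.
by apply/mem_set => j; rewrite elem_intervalE//; exact: h.
Qed.

Lemma elem_boxC (R : realType) (s p r : nat) (u : {ffun 'I_r -> 'I_p.+1})
    (x y : r.-tuple R) : (0 < s)%N ->
  (y \in elem_box s u x) = (x \in elem_box s u y).
Proof.
by move=> s0; rewrite !elem_boxP//; apply: eq_forallb => j; rewrite /same_cell eq_sym.
Qed.

Lemma elem_box_transr (R : realType) (s p r : nat)
    (u : {ffun 'I_r -> 'I_p.+1}) (x y z : r.-tuple R) : (0 < s)%N ->
  x \in elem_box s u y -> (x \in elem_box s u z) = (y \in elem_box s u z).
Proof.
move=> s0; rewrite !elem_boxP// => /forallP h; apply: eq_forallb => j.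
by have := h j; rewrite /same_cell => /eqP ->.
Qed.

(** * Measurability and volume of boxes *)

Lemma measurable_box (R : realType) (r : nat)
    (A : 'I_r -> set (measurableTypeR R)) :
  (forall j, measurable (A j)) ->
  measurable [set t : r.-tuple (measurableTypeR R) |
    forall j, A j (tnth t j)]%classic.
Proof.
move=> mA; rewrite (_ : mkset _ =
    \bigcap_(j in [set: 'I_r]) ((fun t : r.-tuple (measurableTypeR R) => tnth t j) @^-1` A j))%classic.
  apply: fin_bigcap_measurable => // j _; rewrite -[X in measurable X]setTI.
  exact: (@measurable_tnth _ (measurableTypeR R) r j measurableT _ (mA j)).
by apply/seteqP; split => t /= h j; [move=> _|]; exact: h.
Qed.

Lemma measurable_elem_box (R : realType) (s p r : nat)
    (u : {ffun 'I_r -> 'I_p.+1}) (x : r.-tuple (measurableTypeR R)) :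
  measurable (elem_box s u x : set (r.-tuple (measurableTypeR R))).
Proof.
apply: (@measurable_box _ _ (fun j => elem_interval s (u j) (tnth x j))) => j.
exact: measurable_elem_interval.
Qed.

Lemma measurable_unit_cube (R : realType) (r : nat) :
  measurable (@unit_cube R r : set (r.-tuple (measurableTypeR R))).
Proof.
by apply: (@measurable_box _ _ (fun=> `[0%R, 1%R[%classic)) => j; exact: measurable_itv.
Qed.

Lemma lebesgue_tuple_elem_box (R : realType) (s p r : nat)
    (u : {ffun 'I_r -> 'I_p.+1}) (x : r.-tuple R) : (0 < s)%N ->
  lebesgue_tuple R r (elem_box s u x) =
    ((s%:R ^+ (\sum_(j < r) u j)%N)^-1)%:E.
Proof.
move=> s0; rewrite (@lebesgue_tuple_box _ _
  (fun j => elem_interval s (u j) (tnth x j))); last first.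
  by move=> j; exact: measurable_elem_interval.
under eq_bigr do rewrite lebesgue_measure_elem_interval//.
by rewrite prodEFin prodfV prodrXr.
Qed.

Lemma lebesgue_tuple_unit_cube (R : realType) (r : nat) :
  lebesgue_tuple R r (@unit_cube R r) = 1%E.
Proof.
rewrite (@lebesgue_tuple_box _ _ (fun=> `[0%R, 1%R[%classic)); last first.
  by move=> j; exact: measurable_itv.
rewrite big1// => j _; rewrite lebesgue_measure_itv/= lte_fin ltr01.
by rewrite -EFinB subr0.
Qed.

Lemma elem_box_sub (R : realType) (s p r : nat)
    (u : {ffun 'I_r -> 'I_p.+1}) (x : r.-tuple R) : (0 < s)%N ->
  unit_cube x -> (elem_box s u x `<=` @unit_cube R r)%classic.
Proof.
move=> s0 cx y h j; exact: (elem_interval_sub s0 (cx j) (h j)).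
Qed.

(** * Integrating the squared local discrepancy *)

Lemma integrable_indic_bounded d (T : measurableType d) (R : realType)
    (mu : {measure set T -> \bar R}) (D A : set T) :
  measurable D -> (mu D < +oo)%E -> measurable A ->
  mu.-integrable D (EFin \o (\1_A : T -> R)).
Proof.
move=> mD Dfin mA; apply: measurable_bounded_integrable => //.
exists 1; split; first exact: num_real.
move=> y y1 x _ /=; rewrite indicE ger0_norm ?ler0n//.
by apply: le_trans (ltW y1); rewrite lern1; case: (_ \in _).
Qed.

(** The shape that the integrand takes once its square is expanded. Since each [E i] lies in [D],
    restricting the integral to [D] does not cut its measure. *)
Lemma Rintegral_sum_indic d (T : measurableType d) (R : realType)
    (mu : {measure set T -> \bar R}) (D : set T) (I : finType)
    (c0 : R) (c : I -> R) (E : I -> set T) :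
  measurable D -> (mu D < +oo)%E -> (forall i, measurable (E i)) ->
  (forall i, (E i `<=` D)%classic) ->
  \int[mu]_(x in D) (c0 + \sum_i c i * \1_(E i) x) =
    c0 * fine (mu D) + \sum_i c i * fine (mu (E i)).
Proof.
move=> mD Dfin mE ED.
have intE i : mu.-integrable D (EFin \o (\1_(E i) : T -> R)).
  exact: integrable_indic_bounded.
have intcE i : mu.-integrable D (EFin \o (fun x => c i * \1_(E i) x)).
  exact: (integrableZl mD (c i) (intE i)).
have intS : mu.-integrable D (EFin \o (fun x => \sum_i c i * \1_(E i) x)).
  rewrite (_ : _ \o _ = fun x => \sum_i (c i * \1_(E i) x)%:E)%E; last first.
    by apply/funext => x /=; rewrite -sumEFin.
  by apply: integrable_sum => // i _; exact: intcE.
rewrite RintegralD//; last first.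
  by apply: measurable_bounded_integrable => //; exact: bounded_cst.
rewrite Rintegral_cst//; congr (_ + _).
rewrite /Rintegral; under eq_integral do rewrite -sumEFin.
rewrite integral_sum//; transitivity (\sum_i fine (\int[mu]_(x in D) (c i * \1_(E i) x)%:E)).
  by rewrite sum_fine// => i _; apply: integrable_fin_num => //; exact: intcE.
apply: eq_bigr => i _; rewrite -/(Rintegral _ _ _) RintegralZl//; congr (_ * _).
by rewrite /Rintegral integral_indic//; congr (fine (mu _)); apply: setIidl.
Qed.

(** By symmetry the box can be anchored at the fixed point [P i] instead of at the integration
    variable, so the count is a sum of indicators of fixed sets. *)
Lemma card_elem_box (R : realType) (s p r n : nat)
    (u : {ffun 'I_r -> 'I_p.+1}) (P : 'I_n -> r.-tuple R) (x : r.-tuple R) :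
  (0 < s)%N -> #|[pred i | P i \in elem_box s u x]|%:R =
    \sum_i \1_(elem_box s u (P i)) x :> R.
Proof.
move=> s0; rewrite -sum1_card natr_sum big_mkcond/=; apply: eq_bigr => i _.
by rewrite indicE [x \in _]elem_boxC// inE; case: (_ \in _).
Qed.

(* Membership in a common box is an equivalence relation, so the product of two
   indicators is a constant multiple of one of them. *)
Lemma sqr_card_elem_box (R : realType) (s p r n : nat)
    (u : {ffun 'I_r -> 'I_p.+1}) (P : 'I_n -> r.-tuple R) (x : r.-tuple R) :
  (0 < s)%N -> #|[pred i | P i \in elem_box s u x]|%:R ^+ 2 =
    \sum_a (\sum_b (P b \in elem_box s u (P a))%:R)
      * \1_(elem_box s u (P a)) x :> R.
Proof.
move=> s0; rewrite card_elem_box// expr2 mulr_suml; apply: eq_bigr => a _.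
rewrite mulr_sumr mulr_suml; apply: eq_bigr => b _; rewrite !indicE.
have [xa|xa] := boolP (x \in elem_box s u (P a)); last by rewrite mul0r mulr0.
rewrite mul1r mulr1 (elem_box_transr _ s0 xa).
by rewrite elem_boxC.
Qed.

(** All boxes at level [u] have the same volume [V]. The constant term integrates to [V ^+ 2] and
    the cross term to [- 2 * V ^+ 2], which leaves the final [- V ^+ 2]. *)
Lemma Rintegral_elem_box (R : realType) (s p r n : nat)
    (u : {ffun 'I_r -> 'I_p.+1}) (P : 'I_n -> r.-tuple R) :
  (0 < s)%N -> (0 < n)%N -> (forall i, unit_cube (P i)) ->
  \int[lebesgue_tuple R r]_(x in @unit_cube R r)
    (`| (s%:R ^+ (\sum_(j < r) u j)%N)^-1
        - #|[pred i | P i \in elem_box s u x]|%:R / n%:R | ^+ 2) =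
  (s%:R ^+ (\sum_(j < r) u j)%N)^-1 *
    (n%:R ^- 2 * (\sum_a \sum_b (P b \in elem_box s u (P a))%:R)
     - (s%:R ^+ (\sum_(j < r) u j)%N)^-1) :> R.
Proof.
move=> s0 n0 cP; set V := (_ ^+ _)^-1.
have nN0 : n%:R != 0 :> R by rewrite pnatr_eq0 -lt0n.
(* Coefficient of the indicator of the box of [P a]: the quadratic term gives the number of points
   sharing that box, the cross term gives [- 2 * V / n%:R]. *)
pose c a : R := n%:R ^- 2 * (\sum_b (P b \in elem_box s u (P a))%:R) - 2 * V / n%:R.
under eq_Rintegral => x _.
  rewrite (_ : _ ^+ 2 = V ^+ 2 + \sum_a c a * \1_(elem_box s u (P a)) x); last first.
    rewrite real_normK ?num_real//.
    transitivity (V ^+ 2 + (n%:R ^- 2 * #|[pred i | P i \in elem_box s u x]|%:R ^+ 2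
        - 2 * V / n%:R * #|[pred i | P i \in elem_box s u x]|%:R)); first by field.
    congr (_ + _); rewrite sqr_card_elem_box// card_elem_box// !mulr_sumr -sumrB.
    by apply: eq_bigr => a _; rewrite mulrBl mulrA.
  over.
have mE i := @measurable_elem_box R s p r u (P i).
have ED i : (elem_box s u (P i) `<=` @unit_cube R r)%classic by exact: elem_box_sub.
have Dfin : (lebesgue_tuple R r (@unit_cube R r) < +oo)%E.
  by rewrite lebesgue_tuple_unit_cube ltry.
rewrite (Rintegral_sum_indic _ _ (@measurable_unit_cube R r) Dfin mE ED).
rewrite [fine (_ (@unit_cube R r))](congr1 fine (lebesgue_tuple_unit_cube R r)).
rewrite mulr1 (eq_bigr (fun a => c a * V)); last first.
  move=> a _; congr (_ * _).
  exact: (congr1 fine (lebesgue_tuple_elem_box u (P a) s0)).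
rewrite -mulr_suml sumrB -mulr_sumr sumr_const card_ord -[_ *+ n]mulr_natr.
by field.
Qed.

(** * Kernel form of the discrepancy *)

Definition cell_kernel (R : realType) (s p : nat) (omega : 'I_p.+1 -> R)
    (x y : R) : R :=
  \sum_(i < p.+1) omega i / s%:R ^+ i * (same_cell s i x y)%:R.

(** Weight, volume and box indicator all factor over coordinates, so the sum over level vectors [u]
    is a product over [j] of sums over single levels. *)
Lemma SD2_kernel (R : realType) (s p r n : nat) (omega : 'I_p.+1 -> R)
    (P : 'I_n -> r.-tuple R) :
  (0 < s)%N -> (0 < n)%N -> (forall i, unit_cube (P i)) ->
  SD2 s omega P =
    n%:R ^- 2 * (\sum_a \sum_b
      \prod_(j < r) cell_kernel s omega (tnth (P a) j) (tnth (P b) j))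
    - A1 s omega ^+ r.
Proof.
move=> s0 n0 cP; rewrite /SD2.
under eq_bigr do rewrite Rintegral_elem_box// !mulrBr.
rewrite sumrB; congr (_ - _); last first.
  (* The subtracted term carries the volume twice, hence the exponent [2 * i] in [A1]. *)
  rewrite /A1 -[in RHS](card_ord r) -prodr_const bigA_distr_bigA/=.
  apply: eq_bigr => u _; rewrite -expr2 -prodrXr -prodfV -prodrXl.
  rewrite -big_split/=; apply: eq_bigr => j _.
  by rewrite exprVn -exprM mulnC.
transitivity (\sum_(u : {ffun 'I_r -> 'I_p.+1}) n%:R ^- 2 * \sum_a \sum_b
   \prod_(j < r) (omega (u j) / s%:R ^+ u j
     * (same_cell s (u j) (tnth (P a) j) (tnth (P b) j))%:R)).
  apply: eq_bigr => u _; rewrite mulrA mulrCA; congr (_ * _).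
  rewrite mulr_sumr; apply: eq_bigr => a _.
  rewrite mulr_sumr; apply: eq_bigr => b _.
  rewrite !big_split/= prodfV prodrXr; congr (_ * _).
  rewrite elem_boxP//; case: (altP forallP) => [h|/forallPn[j /negbTE h]].
    by rewrite big1// => j _; rewrite h.
  by rewrite (bigD1 j)//= h mul0r.
rewrite -mulr_sumr exchange_big/=; congr (_ * _); apply: eq_bigr => a _.
rewrite exchange_big/=; apply: eq_bigr => b _.
by rewrite [RHS]bigA_distr_bigA.
Qed.

(** * Cells of the design levels as integer quotients *)

Lemma level_point_itv (R : realType) (s p : nat) (x : 'I_(s ^ p)) :
  level_point R x \in `[0, 1[.
Proof.
have q0 : (0 < 2 * s ^ p)%N by have := ltn_ord x; lia.
rewrite in_itv/= /level_point divr_ge0//= ltr_pdivrMr ?ltr0n// mul1r ltr_nat.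
by have := ltn_ord x; lia.
Qed.

(* The half-step offset in [level_point] keeps the point away from the ends of
   its cell, so no rounding occurs at any depth up to [p]. *)
Lemma floor_level_point (R : realType) (s p i : nat) (x : 'I_(s ^ p)) :
  (0 < s)%N -> (i <= p)%N ->
  Num.floor (s%:R ^+ i * level_point R x) = (x %/ s ^ (p - i))%N.
Proof.
move=> s0 ip; have q0 : (0 < s ^ (p - i))%N by rewrite expn_gt0 s0.
have si0 : (0 < s ^ i)%N by rewrite expn_gt0 s0.
have sp : (s ^ p = s ^ i * s ^ (p - i))%N by rewrite -expnD subnKC.
have N0 : (0 < 2 * s ^ p)%N by rewrite muln_gt0 expn_gt0 s0.
apply: floor_def; rewrite -PoszD -!natrX /level_point mulrA -natrM.
rewrite -[(Posz _)%:~R]/(_%:R) -[X in _ < X]/(_%:R).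
rewrite ler_pdivlMr ?ltr0n// ltr_pdivrMr ?ltr0n// -!natrM ler_nat ltr_nat.
(* With [y = d * q + e], [e < q] and [t = s ^ i], cancelling [t] reduces the two bounds to
   [0 <= 2 * e + 1 < 2 * q]. *)
move: (nat_of_ord x) => y; rewrite sp.
have := divn_eq y (s ^ (p - i)); have := ltn_pmod y q0.
move: (y %/ _)%N (y %% _)%N q0 si0 => d e.
move: (s ^ (p - i))%N (s ^ i)%N => q t q0 t0 eq ->.
by apply/andP; split; nia.
Qed.

Lemma same_cell_level_point (R : realType) (s p i : nat) (x y : 'I_(s ^ p)) :
  (0 < s)%N -> (i <= p)%N ->
  same_cell s i (level_point R x) (level_point R y) =
    (x %/ s ^ (p - i) == y %/ s ^ (p - i))%N.
Proof. by move=> s0 ip; rewrite /same_cell !floor_level_point. Qed.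

(** Cells are nested: dividing by [s ^ (p - i)] is dividing by [s ^ (p - j)] and then by
    [s ^ (j - i)], so agreement at the finer level [j] forces agreement at level [i]. *)
Lemma same_cell_level_pointM (R : realType) (s p i j : nat)
    (x y : 'I_(s ^ p)) : (0 < s)%N -> (i <= j)%N -> (j <= p)%N ->
  same_cell s i (level_point R x) (level_point R y) &&
    same_cell s j (level_point R x) (level_point R y) =
  same_cell s j (level_point R x) (level_point R y).
Proof.
move=> s0 ij jp; rewrite !same_cell_level_point//; last exact: leq_trans jp.
rewrite andb_idl// => /eqP e.
have -> : (p - i = p - j + (j - i))%N by lia.
by rewrite expnD !divnMA e.
Qed.

(** * Counting rows of a U-type design by cell *)

Lemma card_divn_eq (N q d : nat) : (0 < q)%N -> (d.+1 * q <= N)%N ->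
  #|[pred l : 'I_N | l %/ q == d]%N| = q.
Proof.
(* The block is the image of the injection sending [r < q] to [d * q + r]; [hN] keeps the whole
   block below [N]. *)
move=> q0 hN.
have lt_f (r : 'I_q) : (d * q + r < N)%N by have := ltn_ord r; lia.
have f_inj : injective (fun r => Ordinal (lt_f r)).
  by move=> r1 r2 [] /addnI /val_inj.
rewrite -[RHS]card_ord -(card_codom f_inj); apply: eq_card => l; rewrite inE.
apply/eqP/codomP => [e|[r ->] /=].
  exists (Ordinal (ltn_pmod l q0)); apply: val_inj => /=.
  by rewrite -e -divn_eq.
by rewrite divnMDl// divn_small// addn0.
Qed.

(** The [s ^ p] level counts are equal and add up to [n]. *)
Lemma U_type_card_level (s p n m : nat) (D : 'M['I_(s ^ p)]_(n, m))
    (k : 'I_m) (l : 'I_(s ^ p)) : U_type D ->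
  (#|[pred i | D i k == l]| * s ^ p = n)%N.
Proof.
move=> hD; rewrite -[RHS]card_ord -[RHS]sum1_card [RHS](partition_big (D^~ k) predT)//=.
rewrite (eq_bigr (fun=> #|[pred i | D i k == l]|)).
  by rewrite sum_nat_const card_ord mulnC.
by move=> l' _; rewrite (hD k l l') -sum1_card.
Qed.

(** A cell at depth [i] consists of [s ^ (p - i)] levels, all taken equally often. *)
Lemma U_type_card_cell (s p n m i : nat) (D : 'M['I_(s ^ p)]_(n, m))
    (k : 'I_m) (l : 'I_(s ^ p)) : (0 < s)%N -> (i <= p)%N -> U_type D ->
  (#|[pred b | l %/ s ^ (p - i) == D b k %/ s ^ (p - i)]| * s ^ i = n)%N.
Proof.
move=> s0 ip hD; set q := (s ^ (p - i))%N.
have q0 : (0 < q)%N by rewrite expn_gt0 s0.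
have sp : (s ^ p = s ^ i * q)%N by rewrite -expnD subnKC.
rewrite -[RHS](U_type_card_level k l hD) [X in _ = (_ * X)%N]sp -sum1_card.
rewrite (partition_big (D^~ k) (fun l' : 'I_(s ^ p) => l' %/ q == l %/ q)%N)/=; last first.
  by move=> b /eqP ->.
rewrite (eq_bigr (fun=> #|[pred i | D i k == l]|)); last first.
  move=> l' /eqP e; rewrite (hD k l l') -sum1_card; apply: eq_bigl => b.
  by rewrite !inE; have [->|] := eqVneq (D b k) l'; rewrite ?andbF// e eqxx.
rewrite sum_nat_const card_divn_eq//; first by lia.
have : (l %/ q < s ^ i)%N by rewrite ltn_divLR// -sp.
by rewrite -(leq_pmul2r q0) -sp.
Qed.

(** * First and second moments of the kernel over all pairs of rows *)

Lemma sum_same_cell (R : realType) (s p n m i : nat)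
    (D : 'M['I_(s ^ p)]_(n, m)) (k : 'I_m) :
  (0 < s)%N -> (i <= p)%N -> U_type D ->
  \sum_a \sum_b
    (same_cell s i (level_point R (D a k)) (level_point R (D b k)))%:R =
  n%:R ^+ 2 / s%:R ^+ i :> R.
Proof.
move=> s0 ip hD.
have si0 : s%:R ^+ i != 0 :> R by rewrite expf_neq0// pnatr_eq0 -lt0n.
(* For fixed [a] the inner sum counts the rows in the cell of [a], with [b = a] included. *)
rewrite (eq_bigr (fun=> n%:R / s%:R ^+ i)); last first.
  move=> a _; apply: (mulIf si0); rewrite divfK//.
  rewrite -[RHS](congr1 _ (U_type_card_cell k (D a k) s0 ip hD)) natrM natrX.
  congr (_ * _); rewrite -sum1_card natr_sum [RHS]big_mkcond/=.
  by apply: eq_bigr => b _; rewrite same_cell_level_point// inE; case: eqP.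
by rewrite sumr_const card_ord -[_ *+ n]mulr_natr expr2 mulrAC.
Qed.

Lemma sum_cell_kernel (R : realType) (s p n m : nat) (omega : 'I_p.+1 -> R)
    (D : 'M['I_(s ^ p)]_(n, m)) (k : 'I_m) : (0 < s)%N -> U_type D ->
  \sum_a \sum_b
    cell_kernel s omega (level_point R (D a k)) (level_point R (D b k)) =
  n%:R ^+ 2 * A1 s omega.
Proof.
move=> s0 hD; rewrite /cell_kernel.
under eq_bigr do rewrite exchange_big/=.
rewrite exchange_big/= /A1 mulr_sumr; apply: eq_bigr => i _.
under eq_bigr do rewrite -mulr_sumr.
rewrite -mulr_sumr sum_same_cell//; last by rewrite -ltnS.
by rewrite mul2n -addnn exprD invfM; ring.
Qed.

(** Used for the double sum over levels, where the diagonal becomes [B] and the strict upper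
    triangle becomes [C]. *)
Lemma sum_sym_ord (V : nmodType) (n : nat) (F : 'I_n -> 'I_n -> V) :
  (forall i j, F i j = F j i) ->
  \sum_(i < n) \sum_(j < n) F i j =
    \sum_(i < n) F i i + (\sum_(i < n) \sum_(j < n | (i < j)%N) F i j) *+ 2.
Proof.
move=> symF.
transitivity (\sum_(i < n) (F i i + (\sum_(j < n | (i < j)%N) F i j
    + \sum_(j < n | (j < i)%N) F i j))).
  apply: eq_bigr => i _; rewrite (bigD1 i)//=; congr (_ + _).
  rewrite (bigID (fun j : 'I_n => (i < j)%N))/=; congr (_ + _);
    by apply: eq_bigl => j; rewrite -val_eqE/=; lia.
rewrite !big_split/= mulr2n; congr (_ + (_ + _)).
rewrite (exchange_big_dep predT)//=.
by apply: eq_bigr => i _; apply: eq_bigr => j _; exact: symF.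
Qed.

Lemma sum_sqr_cell_kernel (R : realType) (s p n m : nat)
    (omega : 'I_p.+1 -> R) (D : 'M['I_(s ^ p)]_(n, m)) (k : 'I_m) :
  (0 < s)%N -> U_type D ->
  \sum_a \sum_b
    cell_kernel s omega (level_point R (D a k)) (level_point R (D b k)) ^+ 2 =
  n%:R ^+ 2 * (B s omega + 2 * C s omega).
Proof.
move=> s0 hD; pose d i a b : R :=
  (same_cell s i (level_point R (D a k)) (level_point R (D b k)))%:R.
pose w (i j : 'I_p.+1) := omega i / s%:R ^+ i * (omega j / s%:R ^+ j).
(* By nesting, the product is the indicator of the finer level [j], so the first moment applies. *)
have sum_dd (i j : 'I_p.+1) : (i <= j)%N ->
    \sum_a \sum_b d i a b * d j a b = n%:R ^+ 2 / s%:R ^+ j.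
  move=> ij; rewrite -(sum_same_cell R k s0 _ hD); last by rewrite -ltnS.
  apply: eq_bigr => a _; apply: eq_bigr => b _.
  by rewrite -natrM mulnb same_cell_level_pointM// -ltnS.
transitivity (\sum_i \sum_j w i j * \sum_a \sum_b d i a b * d j a b).
  transitivity (\sum_a \sum_b \sum_i \sum_j w i j * (d i a b * d j a b)).
    apply: eq_bigr => a _; apply: eq_bigr => b _.
    rewrite expr2 mulr_suml; apply: eq_bigr => i _.
    by rewrite mulr_sumr; apply: eq_bigr => j _; rewrite mulrACA.
  under eq_bigr do rewrite exchange_big/=.
  rewrite exchange_big/=; apply: eq_bigr => i _.
  under eq_bigr do rewrite exchange_big/=.
  rewrite exchange_big/=; apply: eq_bigr => j _.
  under eq_bigr do rewrite -mulr_sumr.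
  by rewrite -mulr_sumr.
rewrite sum_sym_ord; last first.
  move=> i j; rewrite /w [X in X * _]mulrC; congr (_ * _).
  by apply: eq_bigr => a _; apply: eq_bigr => b _; rewrite mulrC.
rewrite mulrDr -[_ *+ 2]mulr_natl [in RHS]mulrCA; congr (_ + 2 * _).
  rewrite /B mulr_sumr; apply: eq_bigr => i _; rewrite sum_dd// /w.
  (* [w i i] supplies two factors [s^(-i)] and the moment a third; off the diagonal the moment
     doubles only the larger index, giving [i + 2 * j]. *)
  by rewrite -[(3 * i)%N]/(i + (i + (i + 0)))%N addn0 !exprD !invfM; ring.
rewrite /C mulr_sumr; apply: eq_bigr => i _.
rewrite mulr_sumr; apply: eq_bigr => j ij; rewrite (sum_dd _ _ (ltnW ij)) /w.
by rewrite mul2n -addnn !exprD !invfM; ring.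
Qed.

(** * Pairs of columns and the final formula *)

Lemma sum_pairs (R : comNzRingType) (I : finType) (x : I -> R) :
  2 * \sum_(A : {set I} | #|A| == 2%N) \prod_(k in A) x k =
    (\sum_k x k) ^+ 2 - \sum_k x k ^+ 2.
Proof.
(* Removing the diagonal leaves the ordered pairs of distinct indices; each two-element set then
   comes from exactly two of them. *)
have -> : (\sum_k x k) ^+ 2 - \sum_k x k ^+ 2 =
    \sum_(q : I * I | q.1 != q.2) x q.1 * x q.2.
  have diag : \sum_(q : I * I | q.1 == q.2) x q.1 * x q.2 = \sum_k x k ^+ 2.
    rewrite -(pair_big_dep predT (fun k l => k == l) (fun k l => x k * x l))/=.
    by apply: eq_bigr => k _; rewrite (big_pred1 k)// => l; rewrite /= eq_sym.
  rewrite expr2 big_distrlr/= pair_big/= (bigID (fun q : I * I => q.1 == q.2))/=.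
  by rewrite diag addrAC subrr add0r.
rewrite (partition_big (fun q : I * I => [set q.1; q.2])
  (fun A : {set I} => #|A| == 2%N))/=; last by move=> q; rewrite cards2 => ->.
rewrite mulr_sumr; apply: eq_bigr => A /cards2P[k [l [kl ->]]].
rewrite big_setU1 ?inE// big_set1 /=.
have lk : (l, k) != (k, l) by rewrite xpair_eqE negb_and eq_sym kl.
rewrite (bigD1 (k, l))/=; last by rewrite kl eqxx.
rewrite (bigD1 (l, k))/=; last by rewrite lk eq_sym kl finset.setUC eqxx.
rewrite big1 ?addr0; first by ring.
(* No third ordered pair remains: [a] and [b] are distinct and both lie in the set of [k] and
   [l]. *)
move=> [a b]/=; rewrite !xpair_eqE => /andP[/andP[/andP[ab /eqP/setP e]]].
have : (a \in [set k; l]) && (b \in [set k; l]) by rewrite -!e !inE !eqxx orbT.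
move: ab; rewrite !inE => ab /andP[ka lb]; move: ab.
by move: ka lb => /orP[]/eqP -> /orP[]/eqP ->; rewrite !eqxx.
Qed.

Lemma hdist_cell_kernel (R : realType) (s p m n : nat) (omega : 'I_p.+1 -> R)
    (D : 'M['I_(s ^ p)]_(n, m)) (a b : 'I_n) :
  hdist omega D a b = m%:R * A0 s omega -
    \sum_k cell_kernel s omega (level_point R (D a k)) (level_point R (D b k)).
Proof.
rewrite mulr_natl -[in X in X - _](card_ord m) -sumr_const -sumrB.
apply: eq_bigr => k _; rewrite /A0 /cell_kernel -sumrB.
by apply: eq_bigr => i _; rewrite mulrBr mulr1.
Qed.

(** Replaces the enumeration of [A] by a product over [k in A], so that the subdesigns for different
    [A] can be summed together. *)
Lemma SD2_design (R : realType) (s p m n : nat) (omega : 'I_p.+1 -> R)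
    (D : 'M['I_(s ^ p)]_(n, m)) (A : {set 'I_m}) : (0 < s)%N -> (0 < n)%N ->
  SD2 s omega (design_points R (colsub (@enum_val _ (mem A)) D)) =
    n%:R ^- 2 * (\sum_a \sum_b \prod_(k in A)
      cell_kernel s omega (level_point R (D a k)) (level_point R (D b k)))
    - A1 s omega ^+ #|A|.
Proof.
move=> s0 n0; rewrite SD2_kernel//; last first.
  by move=> i j; rewrite tnth_mktuple; exact: level_point_itv.
congr (_ * _ - _); apply: eq_bigr => a _; apply: eq_bigr => b _.
by rewrite [RHS]big_enum_val; apply: eq_bigr => j _; rewrite !tnth_mktuple !mxE.
Qed.

Theorem theorem1 (R : realType) (s p m n : nat) (omega : 'I_p.+1 -> R)
    (hs : (2 <= s)%N) (hp : (1 <= p)%N) (hm : (2 <= m)%N) (hn : (1 <= n)%N)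
    (omega_ge0 : forall i, 0 <= omega i) (omega_gt0 : exists i, 0 < omega i)
    (D : 'M['I_(s ^ p)]_(n, m)) (hD : U_type D) :
  Phi_SD omega D =
    1 / (n%:R ^+ 2 * m%:R * (m%:R - 1)) *
      (\sum_(a < n) \sum_(b < n) hdist omega D a b ^+ 2)
    + C_SD s omega m.
Proof.
have s0 : (0 < s)%N by exact: ltnW.
pose K k a b := cell_kernel s omega (level_point R (D a k)) (level_point R (D b k)).
pose S a b := \sum_k K k a b; pose SS := \sum_a \sum_b S a b ^+ 2.
have nN0 : n%:R != 0 :> R by rewrite pnatr_eq0 -lt0n.
have mN0 : m%:R != 0 :> R by rewrite pnatr_eq0; lia.
have m1N0 : m%:R - 1 != 0 :> R by rewrite subr_eq0 pnatr_eq1; lia.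
have sumS : \sum_a \sum_b S a b = m%:R * (n%:R ^+ 2 * A1 s omega).
  under eq_bigr do rewrite exchange_big/=.
  rewrite exchange_big/= (eq_bigr (fun=> n%:R ^+ 2 * A1 s omega)).
    by rewrite sumr_const card_ord [RHS]mulr_natl.
  by move=> k _; exact: sum_cell_kernel.
have sumK2 : \sum_a \sum_b \sum_k K k a b ^+ 2 =
    m%:R * (n%:R ^+ 2 * (B s omega + 2 * C s omega)).
  under eq_bigr do rewrite exchange_big/=.
  rewrite exchange_big/= (eq_bigr (fun=> n%:R ^+ 2 * (B s omega + 2 * C s omega))).
    by rewrite sumr_const card_ord [RHS]mulr_natl.
  by move=> k _; exact: sum_sqr_cell_kernel.
(* In the square of [m%:R * A0 s omega - S a b] the linear term is known from [sumS], so [SS] is the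
   only quantity still depending on the design. *)
have -> : \sum_a \sum_b hdist omega D a b ^+ 2 =
    SS + n%:R ^+ 2 * (m%:R * A0 s omega) ^+ 2
    - 2 * (m%:R * A0 s omega) * (m%:R * (n%:R ^+ 2 * A1 s omega)).
  rewrite -sumS.
  rewrite (_ : n%:R ^+ 2 * _ = \sum_(a < n) \sum_(b < n) (m%:R * A0 s omega) ^+ 2); last first.
    by rewrite !sumr_const card_ord -mulrnA -[RHS]mulr_natl natrM expr2.
  rewrite -big_split/= [X in _ - X]mulr_sumr -sumrB; apply: eq_bigr => a _.
  rewrite -big_split/= [X in _ - X]mulr_sumr -sumrB; apply: eq_bigr => b _.
  by rewrite hdist_cell_kernel -/(S a b); ring.
have -> : Phi_SD omega D = 2 / (m%:R * (m%:R - 1)) *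
    (n%:R ^- 2 * ((SS - m%:R * (n%:R ^+ 2 * (B s omega + 2 * C s omega))) / 2)
     - m%:R * (m%:R - 1) / 2 * A1 s omega ^+ 2).
  rewrite /Phi_SD; congr (_ * _).
  under eq_bigr do rewrite SD2_design//.
  rewrite sumrB -mulr_sumr; congr (_ * _ - _).
    (* The sum over [A] moves inside, so that [sum_pairs] applies for each [a] and [b]. *)
    rewrite exchange_big/=; under eq_bigr do rewrite exchange_big/=.
    apply: (mulfI (_ : 2 != 0)); first by rewrite pnatr_eq0.
    rewrite [RHS]mulrC divfK ?pnatr_eq0// -sumK2 mulr_sumr -sumrB.
    apply: eq_bigr => a _; rewrite mulr_sumr -sumrB; apply: eq_bigr => b _.
    exact: sum_pairs.
  rewrite (eq_bigr (fun=> A1 s omega ^+ 2)); last by move=> A /eqP ->.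
  rewrite sumr_const -[_ *+ _]mulr_natl; congr (_ * _).
  rewrite -cardsE card_draws card_ord.
  apply: (mulIf (_ : 2 != 0)); first by rewrite pnatr_eq0.
  (* The halving in [bin2] is exact because [m * m.-1] is even. *)
  rewrite divfK ?pnatr_eq0// -natrM bin2 muln2 even_halfK; last first.
    by case: (m) => //= k; rewrite oddM andNb.
  by rewrite natrM -subn1 natrB// ltnW.
(* [SS] has coefficient [1 / (n%:R ^+ 2 * m%:R * (m%:R - 1))] on both sides; the remaining terms are
   [C_SD]. *)
rewrite /C_SD; field.
by rewrite nN0 m1N0 mN0.
Qed.
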